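(* For any $\mu\in\mathcal M(\mathbb R^d)$ there exists a point $x\in D^*(\mu)$ such that $$\mathbb R^d=\bigcup\{H\in\mathcal H(x):\mu(\operatorname{int}(H))\le\gamma^*(\mu)\}.$$
   Context: $\mathcal M(\mathbb R^d)$ is the set of finite Borel measures on $\mathbb R^d$. For $x\in\mathbb R^d$ and $u\in\mathbb S^{d-1}$, $H_{x,u}=\{y\in\mathbb R^d:\langle x,u\rangle\le\langle y,u\rangle\}$, and $\mathcal H(x)=\{H_{x,u}:u\in\mathbb S^{d-1}\}$. $\operatorname{int}$ denotes interior. Halfspace depth: $D(x;\mu)=\inf_{H\in\mathcal H(x)}\mu(H)$; $D_\alpha(\mu)=\{x:D(x;\mu)\ge\alpha\}$; $\alpha^*(\mu)=\sup\{\alpha\in\mathbb R:D_\alpha(\mu)\ne\emptyset\}$; the halfspace median set is $D^*(\mu)=D_{\alpha^*(\mu)}(\mu)$. Further, $\gamma^*(\mu)=\inf\{\alpha>0:\operatorname{int}(D_\alpha(\mu))=\emptyset\}$. *)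

(* Defs.v *)
From HB Require Import structures.
From mathcomp Require Import all_boot all_order all_algebra.
From mathcomp Require Import all_classical all_reals all_analysis.

Set Implicit Arguments.
Unset Strict Implicit.
Unset Printing Implicit Defensive.

Import Order.TTheory GRing.Theory Num.Theory.
Import numFieldNormedType.Exports.

Local Open Scope classical_set_scope.
Local Open Scope ring_scope.

(* The topology carried by 'rV[R]_d comes from the maximum norm; it is the
   usual topology of R^d. *)
Notation borel_rV R d := (g_sigma_algebraType (@open 'rV[R]_d)).

Notation finite_borel_measure R d :=
  {finite_measure set (borel_rV R d) -> \bar R}.

Definition dotv (R : realType) (d : nat) (x y : 'rV[R]_d) : R :=
  \sum_(i < d) x ord0 i * y ord0 i.

(* The library norm `|u| on 'rV[R]_d is the maximum norm, so the Euclidean one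
   is spelled out. *)
Definition unit_sphere (R : realType) (d : nat) : set 'rV[R]_d :=
  [set u | Num.sqrt (dotv u u) = 1].

Definition halfspace (R : realType) (d : nat) (x u : 'rV[R]_d) :
    set 'rV[R]_d :=
  [set y | dotv x u <= dotv y u].

Definition halfspaces (R : realType) (d : nat) (x : 'rV[R]_d) :
    set (set 'rV[R]_d) :=
  [set halfspace x u | u in @unit_sphere R d].

(* For 0 < d the family [halfspaces x] is nonempty, so that the infimum lies
   in [0, mu setT] and is finite. *)
Definition depth (R : realType) (d : nat) (mu : finite_borel_measure R d)
    (x : 'rV[R]_d) : \bar R :=
  ereal_inf [set mu H | H in halfspaces x].

Definition depth_region (R : realType) (d : nat)
    (mu : finite_borel_measure R d) (alpha : R) : set 'rV[R]_d :=
  [set x | (alpha%:E <= depth mu x)%E].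

(* [sup] and [inf] on R are 0 by convention when they do not exist. For 0 < d
   the convention is never used: the set below contains 0 and is bounded above
   by mu setT, and the one defining [gamma_star] contains every
   alpha > mu setT and is bounded below by 0. *)
Definition alpha_star (R : realType) (d : nat)
    (mu : finite_borel_measure R d) : R :=
  sup [set alpha : R | depth_region mu alpha !=set0].

Definition median_set (R : realType) (d : nat)
    (mu : finite_borel_measure R d) : set 'rV[R]_d :=
  depth_region mu (alpha_star mu).

Definition gamma_star (R : realType) (d : nat)
    (mu : finite_borel_measure R d) : R :=
  inf [set alpha : R | 0 < alpha /\ (depth_region mu alpha)° = set0].

(* Main.v *)
Require Import Defs.
From HB Require Import structures.
From mathcomp Require Import all_boot all_order all_algebra.
From mathcomp Require Import all_classical all_reals all_analysis.
From mathcomp Require Import lra.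

Set Implicit Arguments.
Unset Strict Implicit.
Unset Printing Implicit Defensive.

Import Order.TTheory GRing.Theory Num.Theory.
Import numFieldNormedType.Exports.

Local Open Scope classical_set_scope.
Local Open Scope ring_scope.

(** Notation: M is the total mass, alpha the maximal depth alpha_star mu and
    gamma the number gamma_star mu; tail u s is the mass of the open halfspace
    s < <y, u>, and in particular tail u <x, u> is the mass of the interior of
    [halfspace x u].  Call x [ray_covered a] if every direction v has a unit
    vector u with 0 <= <v, u> and tail u <x, u> <= a: this says that the closed
    halfspaces at x whose interior has mass at most a cover the space.  One
    wants a median point that is ray_covered gamma.

    The engine is a perturbation argument.  The function tail is lower
    semicontinuous in both variables and the unit sphere is compact; so if x is
    not ray_covered a, witnessed by v, then for a small e > 0 a halfspace with
    normal u at a point near x + e v either contains [halfspace x u], which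
    happens when <v, u> + e < 0, or still has mass more than a + e
    ([tail_gt_perturb]).  Starting from a median point x, this makes all points
    near x + e v have depth at least min (alpha, a + e) ([depth_region_shift]).

    If gamma < alpha, take a = gamma: the open set of points just found lies in
    a depth region of level more than gamma, whose interior is empty by the
    definition of gamma.  So every median point is ray_covered gamma
    ([ray_covered_lt]).

    If alpha <= gamma, it is enough to reach ray_covered alpha.  Moving from x
    to x + e v does not leave the median set now, and one concludes by
    extremality instead: consider
      phi x = min of s - <x, u> over unit u and s with tail u s <= alpha,
    which is nonpositive since no point has depth more than alpha.  If x were
    not ray_covered alpha, the move to x + e v would increase phi by at least
    e^2, so a maximizer of phi on the median set is ray_covered alpha.  It
    exists because the median set is compact when 0 < alpha
    ([exists_ray_covered_median]).

    There remain M <= alpha, where all halfspaces are light enough, and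
    alpha = 0 < M, where the median set is the whole space.  In that last case,
    at every x some open halfspace with x on its boundary is null.  If the
    support of mu affinely spanned the space, the centroid of affinely
    independent spanning points of it would have a support point in each of its
    open halfspaces; so mu lives on a hyperplane, and the two halfspaces that
    this hyperplane bounds cover the space and have null interiors
    ([exists_ray_covered_alpha0]). *)

(** * The Euclidean product on row vectors *)

Section DotProduct.
Variables (R : realType) (d : nat).
Implicit Types (x y u v : 'rV[R]_d) (a : R).

Lemma dotvC x y : dotv x y = dotv y x.
Proof. by apply: eq_bigr => i _; rewrite mulrC. Qed.

Lemma dotvDl x y u : dotv (x + y) u = dotv x u + dotv y u.
Proof.
by rewrite /dotv -big_split; apply: eq_bigr => i _; rewrite mxE mulrDl.
Qed.

Lemma dotvZl a x u : dotv (a *: x) u = a * dotv x u.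
Proof.
by rewrite /dotv mulr_sumr; apply: eq_bigr => i _; rewrite mxE mulrA.
Qed.

Lemma dotvNl x u : dotv (- x) u = - dotv x u.
Proof. by rewrite -scaleN1r dotvZl mulN1r. Qed.

Lemma dotvBl x y u : dotv (x - y) u = dotv x u - dotv y u.
Proof. by rewrite dotvDl dotvNl. Qed.

Lemma dotvDr x u v : dotv x (u + v) = dotv x u + dotv x v.
Proof. by rewrite dotvC dotvDl !(dotvC x). Qed.

Lemma dotvNr x u : dotv x (- u) = - dotv x u.
Proof. by rewrite dotvC dotvNl dotvC. Qed.

Lemma dotvBr x u v : dotv x (u - v) = dotv x u - dotv x v.
Proof. by rewrite dotvDr dotvNr. Qed.

Lemma dotvZr a x u : dotv x (a *: u) = a * dotv x u.
Proof. by rewrite dotvC dotvZl dotvC. Qed.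

Lemma dot0v u : dotv 0 u = 0.
Proof. by rewrite /dotv big1// => i _; rewrite mxE mul0r. Qed.

Lemma dotv_suml (n : nat) (F : 'I_n -> 'rV[R]_d) u :
  dotv (\sum_i F i) u = \sum_i dotv (F i) u.
Proof.
by elim/big_rec2 : _ => [|i r x _ <-]; rewrite ?dot0v// dotvDl.
Qed.

Lemma dotv_delta x (i : 'I_d) : dotv x (delta_mx 0 i) = x 0 i.
Proof.
rewrite /dotv (bigD1 i)//= big1 => [|j ji]; rewrite !mxE ?eqxx ?mulr1 ?addr0//.
by rewrite (negbTE ji) andbF mulr0.
Qed.

Lemma norm_coord x (i : 'I_d) : `|x 0 i| <= `|x|.
Proof.
rewrite [leRHS]/Num.Def.normr /= mx_normrE.
by apply/bigmax_geP; right; exists (0, i).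
Qed.

Lemma norm_rV_le x (r : R) : 0 <= r -> (forall i, `|x 0 i| <= r) -> `|x| <= r.
Proof.
move=> r0 xr; rewrite [leLHS]/Num.Def.normr /= mx_normrE.
by apply/bigmax_leP; split => // -[i j] _ /=; rewrite ord1.
Qed.

Lemma dotv_norm_le x u : `|dotv x u| <= d%:R * (`|x| * `|u|).
Proof.
rewrite (le_trans (ler_norm_sum _ _ _))//.
rewrite [leRHS]mulr_natl -[X in _ *+ X]card_ord -sumr_const.
by apply: ler_sum => i _; rewrite normrM ler_pM// norm_coord.
Qed.

Lemma dotv_continuous x : continuous (dotv x).
Proof.
apply: (@continuous_big R _ +%R 0 xpredT (@add_continuous R) 'rV[R]_d
  (index_enum _) (fun i u => x 0 i * u 0 i)) => i _ u.
by apply: continuousM; [exact: cst_continuous|exact: coord_continuous].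
Qed.

Lemma dotvl_continuous u : continuous (fun x => dotv x u).
Proof.
rewrite (_ : (fun x => dotv x u) = dotv u); first exact: dotv_continuous.
by apply/funext => x; rewrite dotvC.
Qed.

Lemma dotv_ge0 u : 0 <= dotv u u.
Proof. by apply: sumr_ge0 => i _; rewrite -expr2 sqr_ge0. Qed.

Lemma dotv_eq0 u : dotv u u = 0 -> u = 0.
Proof.
move=> /eqP; rewrite psumr_eq0 => [|i _]; last by rewrite -expr2 sqr_ge0.
move=> /allP u0; apply/rowP => i; rewrite mxE.
by have := u0 i (mem_index_enum _); rewrite mulf_eq0 orbb => /eqP.
Qed.

Lemma unit_sphereE u : unit_sphere u <-> dotv u u = 1.
Proof.
rewrite /unit_sphere /=; split => [|->]; last by rewrite sqrtr1.
by move=> /(congr1 (fun r => r ^+ 2)); rewrite expr1n sqr_sqrtr ?dotv_ge0.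
Qed.

Lemma unit_sphereN u : unit_sphere u -> unit_sphere (- u).
Proof. by rewrite !unit_sphereE dotvNl dotvNr opprK. Qed.

Lemma unit_sphere_delta (i : 'I_d) : unit_sphere (delta_mx 0 i : 'rV[R]_d).
Proof. by rewrite unit_sphereE dotv_delta mxE !eqxx. Qed.

Lemma unit_sphere_normalize u : u != 0 ->
  exists c : R, unit_sphere (c *: u).
Proof.
move=> u0; exists (Num.sqrt (dotv u u))^-1; rewrite unit_sphereE dotvZl dotvZr.
rewrite mulrA -expr2 exprVn sqr_sqrtr ?dotv_ge0// mulVf//.
by apply: contraNneq u0 => /dotv_eq0 ->.
Qed.

Lemma unit_sphere_norm_le u : unit_sphere u -> `|u| <= 1.
Proof.
rewrite unit_sphereE => u1; apply: norm_rV_le => // i.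
rewrite -(ler_pXn2r (ltn0Sn 1)) ?nnegrE// expr1n -normrX ger0_norm ?sqr_ge0//.
rewrite -u1 /dotv (bigD1 i)//= expr2 lerDl sumr_ge0// => j _.
by rewrite -expr2 sqr_ge0.
Qed.

Lemma dotv_unit_le x u : unit_sphere u -> `|dotv x u| <= d%:R * `|x|.
Proof.
move=> /unit_sphere_norm_le u1; rewrite (le_trans (dotv_norm_le _ _))//.
by rewrite ler_wpM2l// ler_piMr.
Qed.

Lemma compact_unit_sphere : compact (@unit_sphere R d).
Proof.
apply: bounded_closed_compact.
  exists 1; split => // M M1 u /unit_sphere_norm_le u1.
  exact: le_trans u1 (ltW M1).
rewrite (_ : @unit_sphere R d = (fun u => dotv u u) @^-1` [set 1]); last first.
  by apply/seteqP; split => u /unit_sphereE.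
apply: preimage_closed; last exact: closed_eq.
move=> u _; move: u.
apply: (@continuous_big R _ +%R 0 xpredT (@add_continuous R) 'rV[R]_d
  (index_enum _) (fun i u => u 0 i * u 0 i)) => i _ u.
by apply: continuousM; exact: coord_continuous.
Qed.

End DotProduct.

(** * Masses of open halfspaces *)

Section Tail.
Variables (R : realType) (d : nat) (mu : finite_borel_measure R d).
Implicit Types (x y u v : 'rV[R]_d) (a b s : R) (A B : set 'rV[R]_d).

Definition mass A : R := fine (mu A).

Definition tail u s : R := mass [set y | s < dotv y u].

(** Compact sets that increase to the open halfspace s < <y, u>. *)
Definition truncated u s (n : nat) : set 'rV[R]_d :=
  [set y | s + n.+1%:R^-1 <= dotv y u] `&` [set y | `|y| <= n%:R].

Definition borel A := measurable (A : set (borel_rV R d)).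

Lemma open_borel A : open A -> borel A.
Proof. by move=> oA; apply: sub_sigma_algebra. Qed.

Lemma closed_borel A : closed A -> borel A.
Proof.
move=> cA; rewrite -[A]setCK; apply: measurableC; apply: open_borel.
exact: closed_openC.
Qed.

Lemma massE A : borel A -> (mass A)%:E = mu A.
Proof. by move=> mA; rewrite fineK// fin_num_measure. Qed.

Lemma mass_ge0 A : 0 <= mass A.
Proof. exact: fine_ge0. Qed.

Lemma le_mass A B : borel A -> borel B -> A `<=` B -> mass A <= mass B.
Proof.
by move=> mA mB AB; rewrite -lee_fin !massE// le_measure// inE.
Qed.

Lemma mass_setC A : borel A -> mass (~` A) = mass setT - mass A.
Proof.
move=> mA; have mT : borel setT by exact: measurableT.
apply/eqP; rewrite -eqe EFinB !massE//; last exact: measurableC.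
rewrite -setTD measureD// ?setTI// ltey_eq fin_num_measure//.
Qed.

Lemma open_dotv_gt u s : open [set y | s < dotv y u].
Proof.
rewrite (_ : mkset _ = (fun y => dotv y u) @^-1` [set r | s < r])//.
by apply: open_comp => [y _|]; [exact: dotvl_continuous|exact: open_gt].
Qed.

Lemma closed_dotv_ge u s : closed [set y | s <= dotv y u].
Proof.
rewrite (_ : mkset _ = (fun y => dotv y u) @^-1` [set r | s <= r])//.
by apply: preimage_closed => [y _|]; [exact: dotvl_continuous|exact: closed_ge].
Qed.

Lemma borel_gt u s : borel [set y | s < dotv y u].
Proof. by apply: open_borel; exact: open_dotv_gt. Qed.

Lemma closed_norm_le s : closed [set y : 'rV[R]_d | `|y| <= s].
Proof.
rewrite (_ : mkset _ = (fun y : 'rV[R]_d => `|y|) @^-1` [set r | r <= s])//.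
by apply: preimage_closed => [y _|]; [exact: norm_continuous|exact: closed_le].
Qed.

Lemma borel_norm_le s : borel [set y : 'rV[R]_d | `|y| <= s].
Proof. by apply: closed_borel; exact: closed_norm_le. Qed.

Lemma compact_truncated u s n : compact (truncated u s n).
Proof.
apply: bounded_closed_compact.
  exists n%:R; split => // M nM y [_ /= yn]; exact: le_trans yn (ltW nM).
by apply: closedI; [exact: closed_dotv_ge|exact: closed_norm_le].
Qed.

Lemma borel_truncated u s n : borel (truncated u s n).
Proof.
apply: closed_borel; apply: closedI; first exact: closed_dotv_ge.
exact: closed_norm_le.
Qed.

Lemma tail_inner_approx u s a :
  a < tail u s -> exists n, a < mass (truncated u s n).
Proof.
move=> alt; have mh := borel_gt u s.
have truncatedE : \bigcup_n (truncated u s n : set (borel_rV R d)) =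
    [set y | s < dotv y u].
  apply/seteqP; split => [y [n _ [/= sy _]]|y /= sy].
    by rewrite (lt_le_trans _ sy)// ltrDl invr_gt0.
  near \oo => n; exists n => //; split => /=.
    rewrite -lerBrDl ltW//; near: n.
    have sy0 : 0 < dotv y u - s by rewrite subr_gt0.
    exact: (near_infty_natSinv_lt (PosNum sy0)).
  near: n; exact: nbhs_infty_ger.
have := @nondecreasing_cvg_mu _ _ _ mu (truncated u s) (borel_truncated u s).
rewrite truncatedE => /(_ mh) cvg_mu.
have {}cvg_mu : mu (truncated u s n) @[n --> \oo] --> mu [set y | s < dotv y u].
  apply: cvg_mu => n m nm; apply/subsetPset => y [/= sy yn]; split => /=.
    by rewrite (le_trans _ sy)// lerD2l lef_pV2 ?posrE// ler_nat ltnS.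
  by rewrite (le_trans yn)// ler_nat.
have : \forall n \near \oo, (a%:E < mu (truncated u s n))%E.
  apply: (cvg_mu [set r | (a%:E < r)%E]).
  apply: open_nbhs_nbhs; split; first exact: open_ereal_gt_ereal.
  by rewrite /= -massE// lte_fin.
move=> [n _ /(_ n (leqnn n))] /=.
by rewrite -massE ?lte_fin; [exists n|exact: borel_truncated].
Unshelve. all: by end_near. Qed.

Lemma le_tail u s1 s2 : s1 <= s2 -> tail u s2 <= tail u s1.
Proof.
move=> s12; apply: le_mass; try exact: borel_gt.
by move=> y /=; exact: le_lt_trans.
Qed.

(** A truncated halfspace that already carries mass more than a is bounded and
    at a positive distance from the boundary, so that it stays inside the
    halfspaces obtained by a small change of (u, s). *)
Lemma tail_lsc u s a : a < tail u s ->
  \forall u' \near u & s' \near s, a < tail u' s'.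
Proof.
move=> /tail_inner_approx[n an]; pose e : R := n.+1%:R^-1.
have e0 : 0 < e by rewrite invr_gt0.
near=> u' s'; rewrite (lt_le_trans an)// le_mass//.
- exact: borel_truncated.
- exact: borel_gt.
move=> y [/= sy yn].
have uu' : `|u - u'| * (d%:R * n%:R + 1) < e / 2.
  rewrite -ltr_pdivlMr ?ltr_wpDl//; near: u'.
  apply/(@nbhs_normP R 'rV[R]_d); exists (e / 2 / (d%:R * n%:R + 1)) => //=.
  by rewrite !divr_gt0// ltr_wpDl.
have : `|dotv y (u - u')| <= d%:R * (`|y| * `|u - u'|) by exact: dotv_norm_le.
have : d%:R * (`|y| * `|u - u'|) <= `|u - u'| * (d%:R * n%:R + 1).
  rewrite [leRHS]mulrC mulrA ler_wpM2r// (@le_trans _ _ (d%:R * n%:R)) ?lerDl//.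
  by rewrite ler_wpM2l.
have ss' : s' < s + e / 2.
  by near: s'; apply: lt_nbhsl; rewrite ltrDl divr_gt0.
rewrite ler_norml dotvBr -/e in sy *; lra.
Unshelve. all: by end_near. Qed.

End Tail.

(** * Depth regions *)

Section Depth.
Variables (R : realType) (d : nat) (mu : finite_borel_measure R d).
Implicit Types (x y u v : 'rV[R]_d) (a b s e : R).

(** One positive number e serves as the length of the move along v, as the
    margin on <v, u> and as the gain in mass.  It is uniform in u because near
    each point of the compact unit sphere one of the two alternatives is an
    open condition on (u, e) that holds at e = 0.  The margin e added to <v, u>
    leaves room for a whole neighbourhood of x + e v. *)
Lemma tail_gt_perturb x v a :
  (forall u, unit_sphere u -> 0 <= dotv v u -> a < tail mu u (dotv x u)) ->
  exists2 e, 0 < e & forall u, unit_sphere u ->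
    dotv v u + e < 0 \/ a + e < tail mu u (dotv x u + e * (dotv v u + e)).
Proof.
move=> tail_gt; pose P e u :=
  dotv v u + e < 0 \/ a + e < tail mu u (dotv x u + e * (dotv v u + e)).
have P0 : \forall e \near (0 : R), @unit_sphere R d `<=` P e.
  have /compact_near_coveringP cover := @compact_unit_sphere R d.
  apply: (cover R (nbhs (0 : R)) P _) => u Su.
  have cvg_dot w : dotv w p.1 @[p --> (u, 0 : R)] --> dotv w u.
    exact: (cvg_comp _ _ (@cvg_fst _ _ (nbhs u) (nbhs (0 : R)) _)
      (@dotv_continuous R d w u)).
  have cvg_snd0 : p.2 @[p --> (u, 0 : R)] --> (0 : R) by exact: cvg_snd.
  have cvg_vu : dotv v p.1 + p.2 @[p --> (u, 0 : R)] --> dotv v u.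
    by rewrite -[dotv v u]addr0; apply: cvgD.
  have [vu|vu] := ltP (dotv v u) 0.
    have : \forall p \near (u, 0 : R), dotv v p.1 + p.2 < 0.
      by apply: (cvg_vu [set r | r < 0]); exact: lt_nbhsl.
    by apply: filterS => p ?; left.
  have [b ab btail] : exists2 b, a < b & b < tail mu u (dotv x u).
    by exists ((a + tail mu u (dotv x u)) / 2); have := tail_gt u Su vu; lra.
  have cvg_pos : (p.1, dotv x p.1 + p.2 * (dotv v p.1 + p.2))
      @[p --> (u, 0 : R)] --> (u, dotv x u).
    apply: (@cvg_pair _ _ _ (nbhs (u, 0 : R)) (nbhs u) (nbhs (dotv x u))).
      exact: cvg_fst.
    have -> : dotv x u = dotv x u + 0 * dotv v u by rewrite mul0r addr0.
    exact: (cvgD (cvg_dot x) (cvgM cvg_snd0 cvg_vu)).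
  have near_b : \forall p \near (u, 0 : R),
      b < tail mu p.1 (dotv x p.1 + p.2 * (dotv v p.1 + p.2)).
    have := tail_lsc btail; exact: cvg_pos.
  have near_a : \forall p \near (u, 0 : R), a + p.2 < b.
    have cvg_a : a + p.2 @[p --> (u, 0 : R)] --> a + 0.
      by apply: cvgD => //; exact: cvg_cst.
    by apply: (cvg_a [set r | r < b]); apply: lt_nbhsl; rewrite addr0.
  near=> p; right; rewrite (@lt_trans _ _ b)//; near: p => //.
have [r r0 rP] := (iffLR (@nbhs_normP R R _ _)) P0.
exists (r / 2); first by rewrite divr_gt0.
apply: rP => /=; rewrite sub0r normrN gtr0_norm ?divr_gt0//.
by rewrite ltr_pdivrMr// ltr_pMr// ltr1n.
Unshelve. all: by end_near. Qed.

(** Upper semicontinuity of the masses of closed halfspaces is inherited from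
    [tail_lsc] through this complement. *)
Lemma mass_halfspaceE x u :
  mass mu (halfspace x u) = mass mu setT - tail mu (- u) (dotv x (- u)).
Proof.
rewrite -mass_setC; last exact: borel_gt.
congr mass; apply/seteqP; split => y /=; rewrite /halfspace/= !dotvNr ltrN2.
  by rewrite leNgt => /negP.
by move=> /negP; rewrite -leNgt.
Qed.

Lemma borel_halfspace x u : borel (halfspace x u).
Proof. by apply: closed_borel; exact: closed_dotv_ge. Qed.

Lemma depth_regionP b x :
  depth_region mu b x <->
  forall u, unit_sphere u -> b <= mass mu (halfspace x u).
Proof.
split=> [bx u Su|bx].
  rewrite -lee_fin massE; last exact: borel_halfspace.
  apply: (le_trans bx); apply: ereal_inf_lbound; exists (halfspace x u) => //.
  by exists u.
apply/ereal_infP => _ [_ [u Su <-] <-].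
by rewrite -massE ?lee_fin; [exact: bx|exact: borel_halfspace].
Qed.

Lemma depth_region_tailP b x :
  depth_region mu b x <->
  forall u, unit_sphere u -> tail mu u (dotv x u) <= mass mu setT - b.
Proof.
rewrite depth_regionP; split=> bx u Su.
  have := bx (- u) (unit_sphereN Su).
  by rewrite mass_halfspaceE opprK; lra.
have := bx (- u) (unit_sphereN Su).
by rewrite mass_halfspaceE; lra.
Qed.

Lemma tail_le_halfspace x u : tail mu u (dotv x u) <= mass mu (halfspace x u).
Proof.
apply: le_mass; [exact: borel_gt|exact: borel_halfspace|].
by move=> y /= /ltW.
Qed.

Lemma mass_interior_halfspace x u : unit_sphere u ->
  mass mu (halfspace x u)° <= tail mu u (dotv x u).
Proof.
move=> /unit_sphereE u1; apply: le_mass.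
- by apply: open_borel; exact: open_interior.
- exact: borel_gt.
move=> y /= /(iffLR (@nbhs_normP R 'rV[R]_d _ _))[r r0 rH].
have u10 : 0 < `|u| + 1 by rewrite ltr_wpDl.
pose t := r / (`|u| + 1).
have t0 : 0 < t by rewrite divr_gt0.
(* an interior point can be moved backwards along u, hence is not on the
   boundary hyperplane *)
have : halfspace x u (y - t *: u).
  apply: rH => /=; rewrite opprB addrC subrK normrZ gtr0_norm//.
  by rewrite -[ltRHS](@divfK _ (`|u| + 1)) ?gt_eqF// ltr_pM2l// ltrDl.
by rewrite /halfspace/= dotvBl dotvZl u1; lra.
Qed.

Lemma closed_depth_region b : closed (depth_region mu b).
Proof.
rewrite (_ : depth_region mu b = \bigcap_(u in @unit_sphere R d)
    ~` [set x | mass mu setT - b < tail mu u (dotv x u)]); last first.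
  apply/seteqP; split=> x.
    by move/depth_region_tailP => bx u /bx; rewrite leNgt => /negP.
  by move=> bx; apply/depth_region_tailP => u /bx /= /negP; rewrite -leNgt.
apply: closed_bigI => u _; apply: open_closedC.
rewrite openE => x /= lt_tail; rewrite /interior.
have cvg_pos : (u, dotv y u) @[y --> x] --> (u, dotv x u).
  apply: (@cvg_pair _ _ _ (nbhs x) (nbhs u) (nbhs (dotv x u))).
    exact: cvg_cst.
  exact: dotvl_continuous.
have := tail_lsc lt_tail; exact: cvg_pos.
Qed.

End Depth.

(** * The median set *)

Lemma nested_compact_meet (R : realType) (T : topologicalType) (F : R -> set T)
    (c b : R) :
  c < b -> compact (F c) -> (forall r, closed (F r)) ->
  (forall r s, r <= s -> F s `<=` F r) -> (forall r, r < b -> F r !=set0) ->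
  exists x, forall r, r < b -> F r x.
Proof.
move=> cb cptF clF decF neF; pose G := filter_from [set r | r < b] F.
have GF : ProperFilter G.
  apply: filter_from_proper => //; apply: filter_from_filter; first by exists c.
  move=> r s /= rb sb; exists (Num.max r s); first by rewrite /= gt_max rb.
  by move=> z Fz; split; apply: decF z Fz; rewrite le_max lexx ?orbT.
have [|x [_ clx]] := cptF G GF; first by exists c.
exists x => r rb; apply: clF => B nB; apply: clx => //; exists r => //.
Qed.

Section Median.
Variables (R : realType) (d : nat) (mu : finite_borel_measure R d).
Hypothesis d_gt0 : (0 < d)%N.
Implicit Types (x y u v : 'rV[R]_d) (a b s e : R).

Local Notation M := (mass mu setT).
Local Notation alpha := (alpha_star mu).
Local Notation gamma := (gamma_star mu).

Lemma borelT : borel (setT : set 'rV[R]_d).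
Proof. exact: measurableT. Qed.

Lemma mass_le_total (A : set 'rV[R]_d) : borel A -> mass mu A <= M.
Proof. by move=> mA; apply: le_mass => //; exact: borelT. Qed.

Lemma exists_unit : exists u : 'rV[R]_d, unit_sphere u.
Proof. by exists (delta_mx 0 (Ordinal d_gt0)); exact: unit_sphere_delta. Qed.

(** The null vector turns the tail into the total mass, which lets the inner
    approximation of halfspaces serve for the whole space. *)
Lemma tail_total : tail mu 0 (-1) = M.
Proof.
congr mass; apply/seteqP; split => // y _ /=.
by rewrite dotvC dot0v oppr_lt0.
Qed.

Lemma total_lt_cube a :
  a < M -> exists n : nat, a < mass mu [set y | `|y| <= n%:R].
Proof.
rewrite -tail_total => /tail_inner_approx[n an]; exists n.
rewrite (lt_le_trans an)// le_mass//.
- exact: borel_truncated.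
- exact: borel_norm_le.
by move=> y [].
Qed.

Lemma cube_le_tail u s (n : nat) : unit_sphere u -> s < - (d%:R * n%:R) ->
  mass mu [set y | `|y| <= n%:R] <= tail mu u s.
Proof.
move=> Su sn; apply: le_mass.
- exact: borel_norm_le.
- exact: borel_gt.
move=> y /= yn; have := dotv_unit_le y Su; rewrite ler_norml => /andP[yu _].
by rewrite (lt_le_trans sn)// (le_trans _ yu)// lerN2 ler_wpM2l.
Qed.

Lemma depth_region_dec a b : a <= b -> depth_region mu b `<=` depth_region mu a.
Proof. by move=> ab x; apply: le_trans; rewrite lee_fin. Qed.

(** Comparing with the halfspaces orthogonal to the coordinate axes: beyond a
    large cube they carry less than b. *)
Lemma depth_region_bounded b : 0 < b ->
  exists n : nat, depth_region mu b `<=` [set x | `|x| <= n%:R].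
Proof.
move=> b0; have [n Mn] : exists n : nat, M - b < mass mu [set y | `|y| <= n%:R].
  by apply: total_lt_cube; rewrite gtrBl.
exists n => x /depth_regionP bx; apply: norm_rV_le => // i.
have dot_le u : unit_sphere u -> (forall y, `|dotv y u| <= `|y|) ->
    dotv x u <= n%:R.
  move=> Su yu; rewrite leNgt; apply/negP => xn.
  have : mass mu (halfspace x u) <= M - mass mu [set y | `|y| <= n%:R].
    rewrite -mass_setC; last exact: borel_norm_le.
    apply: le_mass; first exact: borel_halfspace.
      apply: open_borel; apply: closed_openC; exact: closed_norm_le.
    move=> y /= xy yn; have := yu y; rewrite ler_norml => /andP[_ yy].
    by have := lt_le_trans xn xy; rewrite ltNge (le_trans yy).
  by have := bx u Su; lra.
rewrite ler_norml; apply/andP; split.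
  rewrite lerNl -(dotv_delta x) -dotvNr; apply: dot_le => [|y].
    by apply: unit_sphereN; exact: unit_sphere_delta.
  by rewrite dotvNr normrN dotv_delta norm_coord.
rewrite -(dotv_delta x); apply: dot_le => [|y]; first exact: unit_sphere_delta.
by rewrite dotv_delta norm_coord.
Qed.

Lemma compact_depth_region b : 0 < b -> compact (depth_region mu b).
Proof.
move=> /depth_region_bounded[n Dn]; apply: bounded_closed_compact.
  by exists n%:R; split => // m nm x /Dn /= xn; exact: le_trans xn (ltW nm).
exact: closed_depth_region.
Qed.

Lemma depth_region0 x : depth_region mu 0 x.
Proof. by apply/depth_regionP => u _; exact: mass_ge0. Qed.

Lemma depth_le_total b : depth_region mu b !=set0 -> b <= M.
Proof.
move=> [x /depth_regionP bx]; have [u Su] := exists_unit.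
by rewrite (le_trans (bx u Su))// mass_le_total//; exact: borel_halfspace.
Qed.

Lemma le_alpha b : depth_region mu b !=set0 -> b <= alpha.
Proof.
by move=> Db; apply: ub_le_sup => //; exists M => a; exact: depth_le_total.
Qed.

Lemma lt_alpha b : b < alpha -> depth_region mu b !=set0.
Proof.
move=> balpha; have [|a [x ax] ba] := sup_gt _ balpha.
  by exists 0; exists 0; exact: depth_region0.
by exists x; apply: depth_region_dec ax; exact: ltW.
Qed.

Lemma alpha_ge0 : 0 <= alpha.
Proof. by apply: le_alpha; exists 0; exact: depth_region0. Qed.

Lemma median_set_nonempty : median_set mu !=set0.
Proof.
have := alpha_ge0; rewrite le_eqVlt => /predU1P[alpha0|alpha0].
  by exists 0; rewrite /median_set -alpha0; exact: depth_region0.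
have [| |r|r s|r|x xD] :=
    @nested_compact_meet R _ (depth_region mu) (alpha / 2) alpha.
- by rewrite ltr_pdivrMr// ltr_pMr// ltr1n.
- by apply: compact_depth_region; rewrite divr_gt0.
- exact: closed_depth_region.
- exact: depth_region_dec.
- exact: lt_alpha.
exists x; apply/depth_regionP => u Su; apply/ler_addgt0Pl => e e0.
rewrite -lerBlDl; have /xD/depth_regionP/(_ u Su) // : alpha - e < alpha.
by rewrite gtrBl.
Qed.

(** Otherwise the perturbation argument with v = 0 would give x a depth more
    than alpha. *)
Lemma tail_le_alpha x :
  exists2 u, unit_sphere u & tail mu u (dotv x u) <= alpha.
Proof.
apply: contrapT => ntail.
have [u Su _|e e0 tail_e] := @tail_gt_perturb R d mu x 0 alpha.
  by rewrite ltNge; apply/negP => le_tail; apply: ntail; exists u.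
suff : depth_region mu (alpha + e) x.
  by move=> De; have := @le_alpha (alpha + e) (ex_intro _ x De); lra.
apply/depth_regionP => u Su; have := tail_e u Su; rewrite dot0v add0r.
have le_e : dotv x u <= dotv x u + e * e by rewrite lerDl mulr_ge0// ltW.
case=> [|/ltW tail_ee]; first by rewrite ltNge (ltW e0).
rewrite (le_trans tail_ee)// (le_trans (le_tail mu u le_e))//.
exact: tail_le_halfspace.
Qed.

Lemma interior_gt_gamma b : gamma < b -> (depth_region mu b)° = set0.
Proof.
move=> gb; have [|a [a0 Da] ab] := inf_lt _ gb.
  exists (M + 1); split; first by rewrite ltr_wpDl// mass_ge0.
  apply/seteqP; split => // x /interior_subset DM.
  by have := @depth_le_total (M + 1) (ex_intro _ x DM); lra.
apply/seteqP; split => // x; rewrite -Da.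
by apply: interiorS; apply: depth_region_dec; exact: ltW.
Qed.

(** Each halfspace at x' either contains a halfspace at x, of mass at least a,
    or contains the open halfspace of mass more than b of the hypothesis. *)
Lemma depth_region_shift x x' v a b e : 0 < e -> depth_region mu a x ->
  (forall u, unit_sphere u ->
    dotv v u + e < 0 \/ b < tail mu u (dotv x u + e * (dotv v u + e))) ->
  (forall u, unit_sphere u -> dotv x' u <= dotv x u + e * (dotv v u + e)) ->
  depth_region mu (Num.min a b) x'.
Proof.
move=> e0 /depth_regionP ax tail_b x'x; apply/depth_regionP => u Su.
rewrite ge_min; apply/orP; have x'u := x'x u Su.
have [vu|/ltW bu] := tail_b u Su; [left|right].
  rewrite (le_trans (ax u Su))// le_mass//; try exact: borel_halfspace.
  move=> y; apply: le_trans; rewrite (le_trans x'u)// gerDl.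
  by rewrite pmulr_rle0// ltW.
rewrite (le_trans bu)// (le_trans _ (tail_le_halfspace _ _ _))//.
exact: le_tail.
Qed.

End Median.

(** * Covering by light halfspaces *)

Section Cases.
Variables (R : realType) (d : nat) (mu : finite_borel_measure R d).
Implicit Types (x y u v : 'rV[R]_d) (a b s e : R).

Local Notation M := (mass mu setT).
Local Notation alpha := (alpha_star mu).
Local Notation gamma := (gamma_star mu).

(** The vector v stands for y - x, where y is the point to be covered:
    0 <= <v, u> means that y belongs to [halfspace x u]. *)
Definition ray_covered a x := forall v, exists2 u, unit_sphere u &
  0 <= dotv v u /\ tail mu u (dotv x u) <= a.

Lemma not_ray_covered a x : ~ ray_covered a x ->
  exists v, exists2 e, 0 < e & forall u, unit_sphere u ->
    dotv v u + e < 0 \/ a + e < tail mu u (dotv x u + e * (dotv v u + e)).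
Proof.
move=> /existsNP[v vP]; exists v; apply: tail_gt_perturb => u Su vu.
by rewrite ltNge; apply/negP => ?; apply: vP; exists u.
Qed.

Lemma ray_covered_lt (d_gt0 : (0 < d)%N) x :
  gamma < alpha -> median_set mu x -> ray_covered gamma x.
Proof.
move=> gamma_alpha xD; apply: contrapT => /not_ray_covered[v [e e0 tail_e]].
suff : (depth_region mu (Num.min alpha (gamma + e)))° (x + e *: v).
  by rewrite interior_gt_gamma// lt_min gamma_alpha ltrDl.
apply/(@nbhs_normP R 'rV[R]_d); exists (e * e / d%:R) => /=.
  by rewrite divr_gt0 ?mulr_gt0 ?ltr0n.
move=> x' /=; rewrite ltr_pdivlMr ?ltr0n// => x'x.
apply: (depth_region_shift (v := v) e0 xD) => // u Su.
have := dotv_unit_le (x + e *: v - x') Su.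
by rewrite ler_norml dotvBl dotvDl dotvZl; lra.
Qed.

(** The set of x with - r <= phi x, where phi x is the minimum of s - <x, u>
    over unit u and s with tail u s <= alpha. *)
Definition inflated r : set 'rV[R]_d := [set x | forall u s,
  unit_sphere u -> tail mu u s <= alpha -> dotv x u <= s + r].

Lemma closed_inflated r : closed (inflated r).
Proof.
rewrite (_ : inflated r = \bigcap_(p in [set p : 'rV[R]_d * R |
    unit_sphere p.1 /\ tail mu p.1 p.2 <= alpha])
    [set x | - (p.2 + r) <= dotv x (- p.1)]); last first.
  apply/seteqP; split => x /= xP.
    by move=> [u s] /= [Su us]; rewrite dotvNr lerN2; exact: xP.
  by move=> u s Su us; have := xP (u, s) (conj Su us); rewrite /= dotvNr lerN2.
by apply: closed_bigI => p _; exact: closed_dotv_ge.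
Qed.

(** The smallest r for which [inflated r] meets the median set is attained, by
    compactness; the points that attain it are the maximizers of phi.  A
    direction v witnessing that such a point is not covered would lead to a
    median point in [inflated (r - e^2)]. *)
Lemma exists_ray_covered_median (d_gt0 : (0 < d)%N) : 0 < alpha -> alpha < M ->
  exists2 x, median_set mu x & ray_covered alpha x.
Proof.
move=> alpha0 alphaM; pose D r := median_set mu `&` inflated r.
pose radii := [set r | D r !=set0].
have radii_ge0 r : radii r -> 0 <= r.
  move=> [x [_ xr]]; have [u Su le_tail] := tail_le_alpha mu d_gt0 x.
  by have := xr u _ Su le_tail; rewrite lerDl.
have D_inc r s : r <= s -> D r `<=` D s.
  move=> rs x [xD xr]; split => // u t Su ut.
  by rewrite (le_trans (xr u t Su ut))// lerD2l.
have radii_neq0 : radii !=set0.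
  have [x xD] := median_set_nonempty mu d_gt0.
  have [n alpha_n] := total_lt_cube alphaM.
  exists (d%:R * `|x| + d%:R * n%:R); exists x; split => // u s Su us.
  have : - (d%:R * n%:R) <= s.
    rewrite leNgt; apply/negP => /(cube_le_tail mu Su).
    by rewrite leNgt (le_lt_trans us).
  by have := dotv_unit_le x Su; rewrite ler_norml; lra.
have has_inf_radii : has_lbound radii by exists 0.
set r0 := inf radii.
have [||r|r s|r|x xP] :=
    @nested_compact_meet R _ (fun r => D (- r)) (- (r0 + 1)) (- r0).
- by rewrite ltrN2 ltrDl.
- apply: compact_closedI; first exact: compact_depth_region.
  exact: closed_inflated.
- by apply: closedI; [exact: closed_depth_region|exact: closed_inflated].
- by rewrite -lerN2; exact: D_inc.
- rewrite ltrNr => /(inf_lt radii_neq0)[s Ds /ltW sr].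
  by have [x Dx] := Ds; exists x; exact: D_inc Dx.
have xD : median_set mu x by have [] := xP (- (r0 + 1)); rewrite ?ltrN2 ?ltrDl.
have xr0 : inflated r0 x.
  move=> u s Su us; apply/ler_addgt0Pl => e e0.
  have [|_ /(_ u s Su us)] := xP (- (r0 + e)); first by rewrite ltrN2 ltrDl.
  by rewrite opprK addrA [leRHS]addrC.
exists x => //; apply: contrapT => /not_ray_covered[v [e e0 tail_e]].
(* the move to x + e v gains e^2: e times the margin e on <v, u> *)
have e2 : 0 < e * e by rewrite mulr_gt0.
have r0_ge0 : 0 <= r0 by apply: lb_le_inf.
suff : radii (r0 - e * e) by move=> /(ge_inf has_inf_radii); rewrite -/r0; lra.
exists (x + e *: v); split.
  have -> : median_set mu = depth_region mu (Num.min alpha (alpha + e)).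
    by rewrite min_l// lerDl ltW.
  apply: (depth_region_shift (v := v) e0 xD) => // u Su.
  by rewrite dotvDl dotvZl mulrDr; lra.
move=> u s Su us; rewrite dotvDl dotvZl.
have [vu|] := tail_e u Su.
  have : e * (dotv v u + e) <= 0 by rewrite pmulr_rle0// ltW.
  by have := xr0 u s Su us; lra.
have [s_le|s_gt] := leP s (dotv x u + e * (dotv v u + e)).
  by have := le_tail mu u s_le; lra.
by move=> _; lra.
Qed.

(** * Measures of maximal depth zero *)

Definition support : set 'rV[R]_d :=
  [set y | forall U, open U -> U y -> 0 < mass mu U].

(** Compactness in the form: if each point of K has a null neighbourhood, K is
    null.  The covering argument runs along the filter F on sets for which a
    property holds eventually if it holds for all supersets of some null set;
    this is a filter because null sets are stable under binary unions. *)
Lemma compact_meets_support (K : set 'rV[R]_d) : compact K -> borel K ->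
  0 < mass mu K -> exists2 y, K y & support y.
Proof.
move=> cK bK muK; apply: contrapT => no_support.
pose null := [set N : set 'rV[R]_d | borel N /\ mass mu N = 0].
pose F := filter_from null (fun N => [set W | N `<=` W]).
have FF : Filter F.
  apply: filter_from_filter.
    by exists set0; split; [exact: measurable0|rewrite /mass measure0].
  move=> A B [bA A0] [bB B0]; exists (A `|` B); last first.
    by move=> W /= ABW; split => z ?; apply: ABW; [left|right].
  have bAB : borel (A `|` B) by exact: measurableU.
  split => //; apply/eqP; rewrite eq_le mass_ge0 andbT -lee_fin massE//.
  have le_AB : (mu (A `|` B) <= mu A + mu B)%E by exact: measureU2.
  by rewrite (le_trans le_AB)// -(massE mu bA) -(massE mu bB) A0 B0 adde0.
have /compact_near_coveringP cover := cK.
have [|N [bN N0] KN] := cover _ F (fun W y => W y) FF.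
  move=> y Ky; have : ~ support y by move=> ?; apply: no_support; exists y.
  move=> /existsNP[U /not_implyP[oU /not_implyP[Uy /negP]]].
  rewrite -leNgt => U0; exists (U, [set W | U `<=` W]) => /=.
    split; first exact: open_nbhs_nbhs.
    exists U => //; split; first exact: open_borel.
    by apply/eqP; rewrite eq_le U0 mass_ge0.
  by move=> [z W] /= [Uz]; apply.
have := le_mass mu bK bN (KN N (@subset_refl _ N)).
by rewrite N0 leNgt muK.
Qed.

Lemma tail_gt0_support u s : 0 < tail mu u s ->
  exists2 y, support y & s < dotv y u.
Proof.
move=> /tail_inner_approx[n core0].
have [y [/= sy _] Sy] := compact_meets_support (@compact_truncated R d u s n)
  (@borel_truncated R d u s n) core0.
by exists y => //; rewrite (lt_le_trans _ sy)// ltrDl invr_gt0.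
Qed.

Lemma support_le_of_tail0 u s : tail mu u s <= 0 ->
  support `<=` [set y | dotv y u <= s].
Proof.
move=> us y Sy /=; rewrite leNgt; apply/negP => sy.
by have := Sy _ (@open_dotv_gt R d u s) sy; rewrite ltNge us.
Qed.

End Cases.

(** Take the largest family of linearly independent vectors y - y0 with y in S.
    If it does not span, a vector u orthogonal to it is orthogonal to all
    y - y0.  If it does, take the centroid of y0 and of the y of the family: the
    values <y, u> at these points average to the value at the centroid and are
    not all equal, so that one of them is larger. *)
Lemma affine_span_alternative (R : realType) (d : nat) (S : set 'rV[R]_d) y0 :
  S y0 ->
  (exists2 u, unit_sphere u & forall y, S y -> dotv y u = dotv y0 u) \/
  (exists x, forall u, unit_sphere u -> exists2 y, S y & dotv x u < dotv y u).
Proof.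
move=> Sy0; pose P k := exists Y : 'M[R]_(k, d),
  row_free Y /\ forall i, S (y0 + row i Y).
have P0 : exists k, `[< P k >].
  exists 0; apply/asboolP; exists 0; split => [|[]//].
  by rewrite /row_free mxrank0.
have P_le k : `[< P k >] -> (k <= d)%N.
  by move=> /asboolP[Y [/eqP rkY _]]; rewrite -rkY rank_leq_col.
have [k /asboolP[Y [freeY SY]] k_max] := ex_maxnP P0 P_le.
have [[u u0 Yu]|noU] :=
  pselect (exists2 u, u != 0 & forall i, dotv (row i Y) u = 0).
  left; suff Su y : S y -> dotv y u = dotv y0 u.
    have [c cu] := unit_sphere_normalize u0.
    by exists (c *: u) => // y Sy; rewrite !dotvZr Su.
  move=> Sy; apply/eqP; apply: contrapT => /negP yu.
  suff : (k + 1 <= k)%N by rewrite addn1 ltnn.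
  apply: k_max; apply/asboolP; exists (col_mx Y (y - y0)); split.
    rewrite /row_free eqn_leq rank_leq_row /= -addsmxE.
    suff : (Y < Y + (y - y0))%MS.
      by rewrite ltmxErank => /andP[_]; rewrite (eqP freeY) addn1.
    rewrite ltmxE addsmxSl /= addsmx_sub submx_refl /=.
    apply: contra yu => /submxP[D yD].
    rewrite -subr_eq0 -dotvBl yD; apply/eqP.
    rewrite mulmx_sum_row dotv_suml big1// => i _.
    by rewrite dotvZl Yu mulr0.
  move=> i; have [j ->|j ->] := split_ordP i.
    by rewrite rowKu; exact: SY.
  rewrite rowKd (_ : row j _ = y - y0) ?subrKC//.
  by apply/rowP => l; rewrite !mxE ord1.
right; exists (y0 + k.+1%:R^-1 *: \sum_i row i Y) => u Su.
apply: contrapT => no_gt.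
have le_x y : S y -> dotv y u <= dotv (y0 + k.+1%:R^-1 *: \sum_i row i Y) u.
  by move=> Sy; rewrite leNgt; apply/negP => ?; apply: no_gt; exists y.
pose A := \sum_i dotv (row i Y) u.
have xE : dotv (y0 + k.+1%:R^-1 *: \sum_i row i Y) u = dotv y0 u + A / k.+1%:R.
  by rewrite dotvDl dotvZl dotv_suml mulrC.
have A_ge0 : 0 <= A.
  by have := le_x _ Sy0; rewrite xE lerDl pmulr_lge0// invr_gt0.
have Yi_le i : dotv (row i Y) u <= A / k.+1%:R.
  by have := le_x _ (SY i); rewrite xE dotvDl lerD2l.
have A0 : A = 0.
  apply/eqP; rewrite eq_le A_ge0 andbT.
  have : A <= \sum_(i < k) A / k.+1%:R by exact: ler_sum.
  rewrite sumr_const card_ord -[leRHS]mulr_natr mulrAC ler_pdivlMr ?ltr0n//.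
  by rewrite -natr1; lra.
have Yu i : dotv (row i Y) u = 0.
  have : \sum_i - dotv (row i Y) u == 0 by rewrite sumrN -/A A0 oppr0.
  rewrite psumr_eq0 => [/allP/(_ i (mem_index_enum _))|j _].
    by rewrite oppr_eq0 => /eqP.
  by have := Yi_le j; rewrite A0 mul0r oppr_ge0.
apply: noU; exists u => //; apply: contraPneq Su => ->.
by rewrite unit_sphereE dot0v => /eqP; rewrite eq_sym oner_eq0.
Qed.

(** * The ray basis theorem *)

Section RayBasis.
Variables (R : realType) (d : nat) (mu : finite_borel_measure R d).
Implicit Types (x y u v : 'rV[R]_d) (a : R).

Lemma ray_covered_total (d_gt0 : (0 < d)%N) a x :
  mass mu setT <= a -> ray_covered mu a x.
Proof.
move=> Ma v; have [u Su] := exists_unit R d_gt0.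
have tail_le w : tail mu w (dotv x w) <= a.
  by rewrite (le_trans _ Ma)// mass_le_total//; exact: borel_gt.
have [vu|/ltW vu] := leP 0 (dotv v u); first by exists u.
by exists (- u); [exact: unit_sphereN|rewrite dotvNr oppr_ge0].
Qed.

(** The first alternative of [affine_span_alternative] puts the support in the
    hyperplane through y0 orthogonal to u, so that u and - u both give null open
    halfspaces at y0; the second one contradicts the null open halfspace that
    exists at each point. *)
Lemma exists_ray_covered_alpha0 (d_gt0 : (0 < d)%N) :
  alpha_star mu = 0 -> 0 < mass mu setT -> exists x, ray_covered mu 0 x.
Proof.
move=> alpha0 M0.
have [y0 Sy0] : support mu !=set0.
  move: M0; rewrite -tail_total => /tail_gt0_support[y Sy _].
  by exists y.
have [[u Su Hu]|[x x_lt]] := affine_span_alternative Sy0; last first.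
  have [u Su] := tail_le_alpha mu d_gt0 x.
  rewrite alpha0 => /support_le_of_tail0 Sx.
  by have [y /Sx /= yx] := x_lt u Su; rewrite ltNge yx.
have tail0 w : (forall y, support mu y -> dotv y w = dotv y0 w) ->
    tail mu w (dotv y0 w) <= 0.
  move=> Hw; rewrite leNgt; apply/negP => /tail_gt0_support[y /Hw ->].
  by rewrite ltxx.
exists y0 => v; have [vu|/ltW vu] := leP 0 (dotv v u).
  by exists u => //; split => //; exact: tail0.
exists (- u); first exact: unit_sphereN.
split; first by rewrite dotvNr oppr_ge0.
by apply: tail0 => y Sy; rewrite !dotvNr Hu.
Qed.

Lemma exists_median_ray_covered (d_gt0 : (0 < d)%N) :
  exists2 x, median_set mu x & ray_covered mu (gamma_star mu) x.
Proof.
have [x0 x0D] := median_set_nonempty mu d_gt0.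
have [gamma_alpha|alpha_gamma] := ltP (gamma_star mu) (alpha_star mu).
  by exists x0 => //; exact: ray_covered_lt.
suff [x xD xC] : exists2 x, median_set mu x & ray_covered mu (alpha_star mu) x.
  exists x => // v; have [u Su [vu tail_u]] := xC v.
  by exists u => //; split => //; exact: le_trans alpha_gamma.
have [M_alpha|alpha_M] := leP (mass mu setT) (alpha_star mu).
  by exists x0 => //; exact: ray_covered_total.
have := alpha_ge0 mu d_gt0; rewrite le_eqVlt => /predU1P[alpha0|alpha0].
  have [|x xC] := exists_ray_covered_alpha0 d_gt0 (esym alpha0).
    by rewrite alpha0.
  by exists x; rewrite /median_set -alpha0 //; exact: depth_region0.
exact: exists_ray_covered_median.
Qed.

End RayBasis.

Theorem theorem11 (R : realType) (d : nat) (d_gt0 : (0 < d)%N)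
    (mu : finite_borel_measure R d) :
  exists2 x : 'rV[R]_d, median_set mu x &
    [set: 'rV[R]_d] =
    \bigcup_(H in [set H | halfspaces x H /\ (mu H° <= (gamma_star mu)%:E)%E]) H.
Proof.
have [x xD xC] := exists_median_ray_covered mu d_gt0.
exists x => //; apply/esym/seteqP; split => // y _.
have [u Su [yxu tail_u]] := xC (y - x).
exists (halfspace x u); last by move: yxu; rewrite dotvBl subr_ge0.
split; first by exists u.
rewrite -massE; last by apply: open_borel; exact: open_interior.
by rewrite lee_fin (le_trans _ tail_u)// mass_interior_halfspace.
Qed.
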